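(* Let $M$ be a compact Riemannian manifold and $r\ge 0$. Suppose that the image $\mathbf{H}(\mathrm{F}^{r}(\mathbf{M}))$ has two or more elements. Then $\mathbf{H}:(\mathrm{F}^{r}(\mathbf{M}),\tau_{prod})\rightarrow\mathbb{R}\cup\{+\infty\}$ is discontinuous at every $f\in \mathrm{F}^{r}(\mathbf{M})$.
   Context: $M$ is a compact $C^r$ Riemannian manifold with the metric $d$ induced by the Riemannian norm. For $i\in\mathbb{Z}$ put $M_i=M\times\{i\}$, and let $\mathbf{M}=\coprod_{i\in\mathbb{Z}}M_i$ with the metric $\mathbf{d}(x,y)=\min\{1,d(x,y)\}$ if $x,y$ lie in the same $M_i$ and $\mathbf{d}(x,y)=1$ otherwise. $\mathrm{Diff}^{r}(M_i,M_{i+1})$ is the set of $C^r$-diffeomorphisms $M_i\to M_{i+1}$ (homeomorphisms if $r=0$), with the $C^r$-metric $d^r$ induced by the Riemannian metric. $\mathrm{F}^{r}(\mathbf{M})=\prod_{i\in\mathbb{Z}}\mathrm{Diff}^{r}(M_i,M_{i+1})$, and $\tau_{prod}$ is the product topology on it, generated by the sets $\prod_{i<-j}\mathrm{Diff}^{r}(M_i,M_{i+1})\times\prod_{i=-j}^{j}U_i\times\prod_{i>j}\mathrm{Diff}^{r}(M_i,M_{i+1})$ with $j\in\mathbb{N}$ and $U_i$ open in $\mathrm{Diff}^r(M_i,M_{i+1})$. Entropy. For $f=(f_i)_{i\in\mathbb{Z}}$ put $f_i^0=\mathrm{id}_{M_i}$ and $f_i^n=f_{i+n-1}\circ\cdots\circ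 f_i:M_i\to M_{i+n}$ for $n>0$. A compact set $K\subseteq M_i$ is an $(n,\varepsilon)$-span of $M_i$ with respect to $f$ if for each $x\in M_i$ there is $y\in K$ with $\max_{0\le j<n}\mathbf{d}(f_i^j(x),f_i^j(y))<\varepsilon$. Let $r[n,i](\varepsilon,f)$ be the smallest cardinality of an $(n,\varepsilon)$-span of $M_i$, $r[i](\varepsilon,f)=\limsup_{n\to+\infty}\frac1n\log r[n,i](\varepsilon,f)$, and $\mathbf{H}_i(f)=\lim_{\varepsilon\to0}r[i](\varepsilon,f)\in[0,+\infty]$. The value $\mathbf{H}_i(f)$ does not depend on $i$; the common value is denoted $\mathbf{H}(f)$. *)

(* Defs.v *)
From HB Require Import structures.
From mathcomp Require Import all_boot all_order all_algebra.
From mathcomp Require Import all_classical all_reals all_analysis.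

Set Implicit Arguments.
Unset Strict Implicit.
Unset Printing Implicit Defensive.

Import Order.TTheory GRing.Theory Num.Theory.
Import numFieldNormedType.Exports.

Local Open Scope classical_set_scope.
Local Open Scope ring_scope.

Section euclidean.
Context {R : realType} {n : nat} {W : normedModType R}.
Implicit Types (U : set 'rV[R]_n) (f : 'rV[R]_n -> W).

Definition partial (i : 'I_n) f : 'rV[R]_n -> W := 'D_(delta_mx 0 i) f.

(* [iter_partial [:: i1; ...; ik] f] is the mixed partial
   derivative d^k f / dx_i1 ... dx_ik. *)
Definition iter_partial (s : seq 'I_n) f : 'rV[R]_n -> W := foldr partial f s.

(* [f] is of class C^k on [U]; used for open [U] only, so that the values of
   [f] outside [U] are irrelevant. *)
Fixpoint class_C (k : nat) U f : Prop :=
  (forall x, U x -> {for x, continuous f}) /\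
  if k is k'.+1 then
    forall i, (forall x, U x -> derivable f x (delta_mx 0 i)) /\
              class_C k' U (partial i f)
  else True.

End euclidean.

Record chart (R : realType) (n : nat) (M : metricType R) := Chart {
  cdom : set M ;
  cmap : M -> 'rV[R]_n ;
  cinv : 'rV[R]_n -> M ;
  cdom_open : open cdom ;
  ccod_open : open (cmap @` cdom) ;
  cmapK : forall x, cdom x -> cinv (cmap x) = x ;
  cmap_continuous : forall x, cdom x -> {for x, continuous cmap} ;
  cinv_continuous : forall x, cdom x -> {for cmap x, continuous cinv}
}.

(* Manifold of class C^s (s >= 1) and dimension n without boundary, with a
   Riemannian metric of class C^(s-1), the highest regularity of the metric
   that changes of charts of class C^s preserve. [gram c y] is the Gram matrix
   of the metric in the chart [c] at the point of coordinates [y]. A tangent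
   vector with coordinates [v] in the chart [c] has coordinates
   ['D_v (cmap c' \o cinv c)] in the chart [c']; by polarization, comparing the
   quadratic forms is enough to compare the inner products. *)
Record riemannian (R : realType) (s n : nat) (M : metricType R) := Riemannian {
  atlas : set (chart n M) ;
  atlas_cover : forall x, exists2 c, atlas c & cdom c x ;
  atlas_compat : forall c c', atlas c -> atlas c' ->
    class_C s (cmap c @` (cdom c `&` cdom c')) (cmap c' \o cinv c) ;
  gram : chart n M -> 'rV[R]_n -> 'M[R]_n ;
  gram_smooth : forall c, atlas c ->
    class_C s.-1 (cmap c @` cdom c) (gram c) ;
  gram_sym : forall c x, atlas c -> cdom c x ->
    (gram c (cmap c x))^T = gram c (cmap c x) ;
  gram_pos : forall c x (v : 'rV[R]_n), atlas c -> cdom c x -> v != 0 ->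
    0 < (v *m gram c (cmap c x) *m v^T) 0 0 ;
  gram_change : forall c c' x (v : 'rV[R]_n), atlas c -> atlas c' ->
    cdom c x -> cdom c' x ->
    let w := 'D_v (cmap c' \o cinv c) (cmap c x) in
    v *m gram c (cmap c x) *m v^T = w *m gram c' (cmap c' x) *m w^T
}.

Section riemannian_distance.
Context {R : realType} {s n : nat} {M : metricType R}.
Variable X : riemannian s n M.
Implicit Types g : R -> M.

Definition chart_at (x : M) : chart n M := s2val (cid2 (atlas_cover X x)).

(* Riemannian norm of g'(t); it does not depend on the chart, by
   [gram_change]. *)
Definition speed g (t : R) : R :=
  let c := chart_at (g t) in
  let v := derive1 (cmap c \o g) t in
  Num.sqrt ((v *m gram X c (cmap c (g t)) *m v^T) 0 0).

Definition C1_curve g : Prop :=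
  continuous g /\
  forall t c, atlas X c -> cdom c (g t) ->
    derivable (cmap c \o g) t 1 /\
    {for t, continuous (derive1 (cmap c \o g))}.

(* Lengths of the curves from [x] to [y]. Piecewise C^1 curves on [0, 1] give
   the same set of lengths: reparametrize them so that they stop at the break
   points and the end points, then extend them by constants to the real
   line. *)
Definition lengths (x y : M) : set R :=
  [set l | exists g, [/\ C1_curve g, g 0 = x, g 1 = y &
     l = \int[lebesgue_measure]_(t in `[0, 1]) speed g t]].

(* The distance of [M] is the one induced by the Riemannian norm. Points of
   different connected components are joined by no curve; no condition is put
   on their distance, so that a connected manifold is not required. *)
Definition is_riemannian_distance : Prop :=
  forall x y : M, lengths x y !=set0 -> mdist x y = inf (lengths x y).

End riemannian_distance.

Section diffeomorphisms.
Context {R : realType} {s n : nat} {M : metricType R}.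
Variables (X : riemannian s n M) (r : nat).

Definition in_charts (c c' : chart n M) (f : M -> M) : 'rV[R]_n -> 'rV[R]_n :=
  cmap c' \o f \o cinv c.

Definition Cr_map (f : M -> M) : Prop :=
  continuous f /\
  forall c c', atlas X c -> atlas X c' ->
    class_C r (cmap c @` (cdom c `&` f @^-1` cdom c')) (in_charts c c' f).

(* Homeomorphisms if r = 0. *)
Record diffeo := Diffeo {
  dfun :> M -> M ;
  dinv : M -> M ;
  dfunK : cancel dfun dinv ;
  dinvK : cancel dinv dfun ;
  dfun_Cr : Cr_map dfun ;
  dinv_Cr : Cr_map dinv
}.

HB.instance Definition _ := gen_eqMixin diffeo.
HB.instance Definition _ := gen_choiceMixin diffeo.

(* The maps whose derivatives of order at most r, read in the charts [c] and
   [c'], are [e]-close to those of [f] on [K]. *)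
Definition Cr_near (c c' : chart n M) (K : set M) (f : diffeo) (e : R) :
    set diffeo :=
  [set g : diffeo | forall x, K x -> cdom c' (g x) /\
    forall i : seq 'I_n, (size i <= r)%N ->
      `|iter_partial i (in_charts c c' f) (cmap c x) -
        iter_partial i (in_charts c c' g) (cmap c x)| < e].

Definition Cr_subbase : set (set diffeo) :=
  [set U | exists (c c' : chart n M) (K : set M) (f : diffeo) (e : R),
     [/\ atlas X c /\ atlas X c', compact K /\ K `<=` cdom c,
         f @` K `<=` cdom c', 0 < e & U = Cr_near c c' K f e]].

(* The C^r topology. On a compact manifold, the metrics d^r all induce it,
   whatever the norms chosen on the derivatives. *)
HB.instance Definition _ := isSubBaseTopological.Build diffeo Cr_subbase id.

(* The component M_i of the disjoint union of the copies M x {i} is identified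
   with M, so that the diffeomorphisms M_i -> M_(i+1) are those of M.
   [prod_topology] carries the product topology. *)
Definition seq_diffeo : topologicalType :=
  prod_topology (fun _ : int => diffeo : topologicalType).

End diffeomorphisms.

Section entropy.
Context {R : realType} {s n : nat} {M : metricType R}.
Variables (X : riemannian s n M) (r : nat).
Implicit Types (f : seq_diffeo X r) (i : int) (e : R).

(* The distance of the disjoint union of the copies M x {i}. *)
Definition union_dist (p q : M * int) : R :=
  if p.2 == q.2 then Num.min 1 (mdist p.1 q.1) else 1.

(* [orbit_map f i k] is f_(i+k-1) o ... o f_i : M_i -> M_(i+k). *)
Fixpoint orbit_map f i (k : nat) : M -> M :=
  if k is k'.+1 then (f (i + k'%:Z) : diffeo X r) \o orbit_map f i k' else id.

Definition orbit_dist f i (m : nat) (x y : M) : R :=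
  \big[Num.max/0]_(j < m)
    union_dist (orbit_map f i j x, i + j%:Z) (orbit_map f i j y, i + j%:Z).

Definition is_span f i (m : nat) e (K : set M) : Prop :=
  compact K /\ forall x, exists2 y, K y & orbit_dist f i m x y < e.

(* The smallest cardinality of a span: the infimum is attained, being taken over
   natural numbers, and finite spans exist because [M] is compact. *)
Definition min_span f i (m : nat) e : R :=
  inf [set k%:R | k in [set k : nat |
    exists K, is_span f i m e K /\ (K #= `I_k)%card]].

Definition span_rate f i e : \bar R :=
  limn_esup (fun m => (m%:R^-1 * ln (min_span f i m e))%:E).

Definition entropy_at i f : \bar R := lim (span_rate f i e @[e --> 0^'+]).

(* [entropy_at i f] does not depend on [i]. *)
Definition entropy f : \bar R := entropy_at 0 f.

End entropy.

Arguments entropy {R s n M} X r f.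

(* Main.v *)
(* Replacing the tail (f_i)_(i >= N) by that of a sequence g of different
   entropy gives sequences that tend to f as N tends to infinity. Their entropy
   is that of g: pushing spans forward by f_i, or pulling them back by its
   inverse, which is uniformly continuous, shows that the entropy does not
   depend on the base component, and at the component N only the terms of
   index >= N matter. *)
Require Import Defs.
From HB Require Import structures.
From mathcomp Require Import all_boot all_order all_algebra.
From mathcomp Require Import all_classical all_reals all_analysis.
From mathcomp Require Import finmap zify lra.

Set Implicit Arguments.
Unset Strict Implicit.
Unset Printing Implicit Defensive.

Import Order.TTheory GRing.Theory Num.Theory.
Import numFieldNormedType.Exports.

Local Open Scope classical_set_scope.
Local Open Scope ring_scope.


(** * Upper limits of sequences compared up to a shift *)

Section limsup.
Context {R : realType}.
Implicit Types u v : R^nat.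
Local Open Scope ereal_scope.

(** Serves for spans of length [m.+1] at a component built from spans of length [m] at the next
    one. *)
Lemma limn_esup_shift_le u v : (forall m, (0 < m)%N -> (u m.+1 <= v m)%R) ->
  limn_esup (EFin \o u) <= limn_esup (EFin \o v).
Proof.
move=> uv; apply: le_ereal_inf_tmp => _ [V [N _ NV] <-].
apply: le_trans (ereal_inf_lbound _) _.
  exists [set m | (N.+1 < m)%N] => //; exists N.+2 => //.
apply: ge_ereal_sup => _ [[//|m] /= Nm <-].
apply: le_ereal_sup_tmp; exists (v m)%:E; last by rewrite lee_fin uv//; lia.
by exists m => //; apply: NV => /=; lia.
Qed.

(** The factor $(m+1)/m$ tends to 1, which is harmless as soon as the upper limit of [v] is finite;
    otherwise there is nothing to prove. *)
Lemma limn_esup_succ_le u v : (forall m, 0 <= v m)%R ->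
  (forall m, (0 < m)%N -> (u m <= m.+1%:R / m%:R * v m.+1)%R) ->
  limn_esup (EFin \o u) <= limn_esup (EFin \o v).
Proof.
move=> v0 uv.
have L0 : 0 <= limn_esup (EFin \o v).
  by apply: limf_esup_ge0 => [[N _ /(_ N (leqnn _))]//|m]; rewrite lee_fin.
have [Loo|Lfin] := eqVneq (limn_esup (EFin \o v)) +oo; first by rewrite Loo leey.
have /fineK <- : limn_esup (EFin \o v) \is a fin_num by rewrite ge0_fin_numE// ltey.
have := L0; set r := fine _ => _.
have r0 : (0 <= r)%R by exact: fine_ge0.
apply/lee_addgt0Pr => e e0.
have /ereal_inf_lt[_ [V [N _ NV] <-] supV] : limn_esup (EFin \o v) < (r + e / 2)%:E.
  rewrite EFinD fineK ?ge0_fin_numE ?ltey// lteDl ?ge0_fin_numE ?ltey//.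
  by rewrite lte_fin divr_gt0.
apply: le_trans (ereal_inf_lbound _) _.
  (* For $m \ge (r+e/2)/(e/2)$ one has $(1+1/m)(r+e/2) \le r+e$. *)
  exists [set m | (maxn N (Num.bound ((r + e / 2) / (e / 2))) < m)%N] => //.
  by exists (maxn N (Num.bound ((r + e / 2) / (e / 2)))).+1.
apply: ge_ereal_sup => _ [m /= Nm <-].
rewrite lee_fin; move: Nm; rewrite gtn_max => /andP[Nm bm].
have m0 : (0 < m)%N by lia.
have vm : (v m.+1 <= r + e / 2)%R.
  rewrite -lee_fin; apply: le_trans (ltW supV); apply: ereal_sup_ubound.
  by exists m.+1 => //; apply: NV => /=; lia.
have small : ((r + e / 2) / (e / 2) <= m%:R)%R.
  apply/ltW/(lt_le_trans (archi_boundP _)); last by rewrite ler_nat ltnW.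
  by rewrite divr_ge0// ?addr_ge0// ?divr_ge0// ltW.
apply: le_trans (uv _ m0) _.
apply: (@le_trans _ _ (m.+1%:R / m%:R * (r + e / 2)))%R.
  by rewrite ler_wpM2l// divr_ge0.
have mR : (0 < m%:R :> R)%R by rewrite ltr0n.
rewrite mulrAC ler_pdivrMr// -natr1.
by move: small; rewrite ler_pdivrMr ?divr_gt0//; lra.
Qed.

End limsup.

(** * Logarithms of integers and consequences of compactness *)

Lemma ln_nat_ge0 {R : realType} (k : nat) : 0 <= ln (k%:R : R).
Proof.
(* The value 0 does occur, as the size of the empty span of an empty manifold; [ln] is 0 there. *)
by case: k => [|k]; [rewrite ln0 | apply: ln_ge0; rewrite ler1n].
Qed.

Lemma ler_ln_nat {R : realType} (k l : nat) :
  (k <= l)%N -> ln (k%:R : R) <= ln (l%:R : R).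
Proof.
case: k => [_|k kl]; first by rewrite ln0 ?ln_nat_ge0.
by rewrite ler_ln ?posrE ?ltr0n ?ler_nat//; lia.
Qed.

(** Heine-Cantor: half of a radius of continuity at $x$ works for all points near $x$, and the
    near-covering form of compactness makes the choice uniform. *)
Lemma compact_unif_continuous {R : realType} {M : metricType R} (g : M -> M) e :
  compact [set: M] -> continuous g -> 0 < e ->
  exists2 d, 0 < d & forall x y, mdist x y < d -> mdist (g x) (g y) < e.
Proof.
move=> /compact_near_coveringP cM cg e0.
have nearP x : nbhs (g x) [set z | mdist (g x) z < e / 2].
  by rewrite -ballEmdist; apply: nbhsx_ballx; rewrite divr_gt0.
have : \forall d \near 0^'+,
    [set: M] `<=` [set x | forall y, mdist x y < d -> mdist (g x) (g y) < e].
  apply: cM => x _.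
  have /nbhs_ballP[d /= d0 dP] := cg x _ (nearP x).
  exists (ball x (d / 2), [set t | t < d / 2]).
    split; first by apply: nbhsx_ballx; rewrite divr_gt0.
    by apply: nbhs_right_lt; rewrite divr_gt0.
  move=> [z t] [/= xz td] y zy.
  have /dP/= gz : ball x d z by apply: le_ball xz; lra.
  have /dP/= gy : ball x d y.
    by rewrite (splitr d); apply: ball_triangle xz _; rewrite ballEmdist/=; lra.
  rewrite (le_lt_trans (metric_triangle _ (g x) _))// metric_sym.
  by rewrite (splitr e) ltrD.
move=> H; have [d [dP d0]] := filter_ex (filterI H (nbhs_right_gt (0 : R))).
by exists d => // x y; exact: dP.
Qed.

(* [compact_cover] needs a base point; here the space may be empty. *)
Lemma compact_finite_subcover {T : topologicalType} (U : T -> set T) :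
  compact [set: T] -> (forall x, nbhs x (U x)) ->
  exists2 K : set T, finite_set K & forall x, exists2 y, K y & U y x.
Proof.
have pointed_case (S : ptopologicalType) (V : S -> set S) :
    compact [set: S] -> (forall x, nbhs x (V x)) ->
    exists2 K : set S, finite_set K & forall x, exists2 y, K y & V y x.
  rewrite compact_cover => cS nV.
  have [||D _ cD] := cS S [set: S] (fun x => (V x)^°).
  - by move=> x _; exact: open_interior.
  - by move=> x _; exists x => //; exact: nV.
  - exists [set` D] => // x; have [y Dy Vy] := cD x I.
    by exists y => //; exact: interior_subset.
move=> cT nU; have [[x0 _]|T0] := pselect ([set: T] !=set0); last first.
  by exists set0 => // x; case: T0; exists x.
pose Tp : ptopologicalType := HB.pack T (isPointed.Build T x0).
exact: (pointed_case Tp).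
Qed.

(** * Spans, and independence of the entropy from the base component *)

Section spans.
Context {R : realType} {s n : nat} {M : metricType R}.
Variables (X : riemannian s n M) (r : nat).
Implicit Types (f : seq_diffeo X r) (i : int) (e : R) (m k : nat).

Lemma diffeo_continuous f i : continuous (f i : diffeo X r).
Proof. exact: (dfun_Cr (f i : diffeo X r)).1. Qed.

Lemma orbit_map_continuous f i k : continuous (orbit_map f i k).
Proof.
elim: k => [|k IH] x /=; first exact: cvg_id.
by apply: continuous_comp; [exact: IH | exact: diffeo_continuous].
Qed.

(** [orbit_map] grows at its outer end; moving the base component requires peeling off the innermost
    map instead. *)
Lemma orbit_mapS f i k x :
  orbit_map f i k.+1 x = orbit_map f (i + 1) k ((f i : diffeo X r) x).
Proof.
elim: k => [|k IH]; first by rewrite /= addr0.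
have -> : orbit_map f i k.+2 x =
  (f (i + k.+1%:Z) : diffeo X r) (orbit_map f i k.+1 x) by [].
by rewrite IH /= -addrA -PoszD add1n.
Qed.

Lemma orbit_dist_ltP f i m x y e : 0 < e ->
  orbit_dist f i m x y < e <->
  forall j, (j < m)%N ->
    Num.min 1 (mdist (orbit_map f i j x) (orbit_map f i j y)) < e.
Proof.
move=> e0; rewrite /orbit_dist; split.
  move=> /bigmax_ltP[_ H] j jm; have := H (Ordinal jm) isT.
  by rewrite /union_dist/= eqxx.
move=> H; apply/bigmax_ltP; split=> // j _.
by rewrite /union_dist/= eqxx; exact: H.
Qed.

Lemma is_span_le f i m e e' K : e <= e' ->
  is_span f i m e K -> is_span f i m e' K.
Proof.
move=> ee' [cK sK]; split=> // x; have [y Ky xy] := sK x.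
by exists y => //; exact: lt_le_trans xy ee'.
Qed.

(** The orbit of $f_i(y)$ is that of $y$ without its first point, so only the condition at time 0 is
    lost. *)
Lemma is_span_image f i m e K : 0 < e ->
  is_span f i m.+1 e K -> is_span f (i + 1) m e ((f i : diffeo X r) @` K).
Proof.
move=> e0 [cK sK]; split.
  apply: continuous_compact => //; apply: continuous_subspaceT.
  exact: diffeo_continuous.
move=> x.
have [y Ky /(orbit_dist_ltP _ _ _ _ _ e0) xy] := sK (Defs.dinv (f i : diffeo X r) x).
exists ((f i : diffeo X r) y); first by exists y.
apply/orbit_dist_ltP => // j jm; have := xy j.+1 jm.
by rewrite !orbit_mapS dinvK.
Qed.

(** Pulling back adds a condition at time 0, which follows from the closeness of the images by the
    modulus of continuity of the inverse. That closeness is available because [0 < m], and [d <= 1]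
    keeps the truncation of the distance at 1 from hiding it. *)
Lemma is_span_preimage f i m e d K : 0 < e -> 0 < d <= 1 -> d <= e ->
  (forall x y, mdist x y < d ->
    mdist (Defs.dinv (f i : diffeo X r) x) (Defs.dinv (f i : diffeo X r) y) < e) ->
  (0 < m)%N -> is_span f (i + 1) m d K ->
  is_span f i m.+1 e (Defs.dinv (f i : diffeo X r) @` K).
Proof.
move=> e0 /andP[d0 d1] de fd m0 [cK sK]; split.
  apply: continuous_compact => //; apply: continuous_subspaceT.
  exact: (dinv_Cr (f i : diffeo X r)).1.
move=> x.
have [y Ky /(orbit_dist_ltP _ _ _ _ _ d0) xy] := sK ((f i : diffeo X r) x).
exists (Defs.dinv (f i : diffeo X r) y); first by exists y.
apply/orbit_dist_ltP => // -[_|j jm].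
  have := xy 0%N m0; rewrite /= gt_min ltNge d1/= => /fd.
  by rewrite dfunK gt_min => ->; rewrite orbT.
by rewrite !orbit_mapS dinvK; apply: lt_le_trans (xy j jm) de.
Qed.

Hypothesis cM : compact [set: M].

Lemma finite_span_exists f i m e : 0 < e ->
  exists k K, is_span f i m e K /\ (K #= `I_k)%card.
Proof.
move=> e0.
(* Finitely many continuous iterates are involved. The centre is the second argument, to match
   [is_span]. *)
have nb x : nbhs x [set y | orbit_dist f i m y x < e].
  have : \forall y \near x, forall j : 'I_m,
      mdist (orbit_map f i j x) (orbit_map f i j y) < e.
    apply: filter_forall => j.
    have nj : nbhs (orbit_map f i j x) [set z | mdist (orbit_map f i j x) z < e].
      by rewrite -ballEmdist; exact: nbhsx_ballx.
    exact: orbit_map_continuous nj.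
  apply: filterS => y xy; apply/orbit_dist_ltP => // j jm.
  by rewrite gt_min metric_sym (xy (Ordinal jm)) orbT.
have [K fK sK] := compact_finite_subcover cM nb.
have [k Kk] := fK.
by exists k, K; split=> //; split=> //; exact: finite_compact.
Qed.

Lemma min_span_le f i m e k K : is_span f i m e K -> (K #= `I_k)%card ->
  min_span f i m e <= k%:R.
Proof.
move=> sK Kk; apply: ge_inf; last by exists k => //; exists K.
by exists 0 => _ [l _ <-].
Qed.

Lemma min_spanP f i m e : 0 < e -> exists k, min_span f i m e = k%:R /\
  exists K, is_span f i m e K /\ (K #= `I_k)%card.
Proof.
move=> e0; have [k0 Hk0] := finite_span_exists f i m e0.
pose P k := `[< exists K, is_span f i m e K /\ (K #= `I_k)%card >].
have exP : exists k, P k by exists k0; apply/asboolP.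
have [k /asboolP Pk kmin] := ex_minnP exP.
exists k; split=> //; apply/eqP; rewrite eq_le; apply/andP; split.
  by have [K [sK Kk]] := Pk; exact: min_span_le Kk.
apply: lb_le_inf; first by exists k%:R, k.
by move=> _ [l Hl <-]; rewrite ler_nat kmin//; exact/asboolP.
Qed.

Lemma ln_min_span_ge0 f i m e : 0 < e -> 0 <= ln (min_span f i m e).
Proof. by move=> /(min_spanP f i m)[k [-> _]]; exact: ln_nat_ge0. Qed.

(** Reduces comparisons of growth to turning spans into spans of the same cardinality. *)
Lemma ln_min_span_le f i m e f' i' m' e' : 0 < e -> 0 < e' ->
  (forall k K, is_span f' i' m' e' K -> (K #= `I_k)%card ->
    exists2 K', is_span f i m e K' & (K' #= `I_k)%card) ->
  ln (min_span f i m e) <= ln (min_span f' i' m' e').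
Proof.
move=> e0 e'0 H; have [k [k_def _]] := min_spanP f i m e0.
have [l [l_def [K [sK Kl]]]] := min_spanP f' i' m' e'0.
have [K' sK' K'l] := H _ _ sK Kl.
by rewrite k_def l_def ler_ln_nat// -(ler_nat R) -k_def; exact: min_span_le K'l.
Qed.

Lemma span_rate_nonincreasing f i e e' : 0 < e -> e <= e' ->
  (span_rate f i e' <= span_rate f i e)%E.
Proof.
move=> e0 ee'; have e'0 := lt_le_trans e0 ee'.
apply: le_ereal_inf_tmp => _ [V oV <-]; apply: le_trans (ereal_inf_lbound _) _.
  by exists V.
apply: ge_ereal_sup => _ [m Vm <-]; apply: le_ereal_sup_tmp.
exists ((m%:R^-1 * ln (min_span f i m e))%:E); first by exists m.
rewrite lee_fin ler_wpM2l ?invr_ge0// ln_min_span_le// => k K sK Kk.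
by exists K => //; exact: is_span_le sK.
Qed.

(** By monotonicity in [e] the limit is a supremum, so rates may be compared at different scales. *)
Lemma entropy_atE f i :
  entropy_at i f = ereal_sup (span_rate f i @` [set e | 0 < e]).
Proof.
have -> : [set e : R | 0 < e] = [set` `]0, +oo[%R].
  by apply/seteqP; split=> e /=; rewrite in_itv/= andbT.
apply/cvg_lim => //; apply: nonincreasing_at_right_cvge => // e e'.
by rewrite !in_itv/= !andbT => e0 _; exact: span_rate_nonincreasing.
Qed.

Lemma span_rate_succ_le f i e : 0 < e ->
  (span_rate f (i + 1) e <= span_rate f i e)%E.
Proof.
move=> e0; apply: limn_esup_succ_le => [m|m m0].
  by rewrite mulr_ge0 ?invr_ge0 ?ln_min_span_ge0.
(* The factor corrects the normalization, since a span of length [m] comes from one of length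
   [m.+1]. *)
have -> (a : R) : m.+1%:R / m%:R * (m.+1%:R^-1 * a) = m%:R^-1 * a.
  by rewrite mulrA (mulrAC m.+1%:R) divff ?mul1r// pnatr_eq0.
rewrite ler_wpM2l ?invr_ge0// ln_min_span_le// => k K sK Kk.
exists ((f i : diffeo X r) @` K); first exact: is_span_image.
apply: card_eq_trans Kk; apply: inj_card_eq => x y _ _.
exact: (can_inj (dfunK (f i : diffeo X r))).
Qed.

Lemma span_rate_le_succ f i e : 0 < e ->
  exists2 d, 0 < d & (span_rate f i e <= span_rate f (i + 1) d)%E.
Proof.
move=> e0.
have [d' d'0 fd'] := compact_unif_continuous cM
  (dinv_Cr (f i : diffeo X r)).1 e0.
(* The three bounds are those that [is_span_preimage] asks for. *)
pose d := Num.min d' (Num.min 1 e).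
have d0 : 0 < d by rewrite !lt_min d'0 e0 ltr01.
exists d => //; apply: limn_esup_shift_le => m m0.
apply: (@le_trans _ _ (m%:R^-1 * ln (min_span f i m.+1 e))).
  by rewrite ler_wpM2r ?ln_min_span_ge0// lef_pV2 ?posrE ?ltr0n// ler_nat.
rewrite ler_wpM2l ?invr_ge0// ln_min_span_le// => k K sK Kk.
exists (Defs.dinv (f i : diffeo X r) @` K).
  apply: is_span_preimage sK => //.
  - by rewrite d0 /d !ge_min lexx !orbT.
  - by rewrite /d !ge_min lexx !orbT.
  - by move=> x y xy; apply: fd'; apply: lt_le_trans xy _; rewrite ge_min lexx.
apply: card_eq_trans Kk; apply: inj_card_eq => x y _ _.
exact: (can_inj (dinvK (f i : diffeo X r))).
Qed.

Lemma entropy_at_succ f i : entropy_at (i + 1) f = entropy_at i f.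
Proof.
rewrite !entropy_atE; apply/eqP; rewrite eq_le; apply/andP; split.
  apply: ge_ereal_sup => _ [e /= e0 <-]; apply: le_ereal_sup_tmp.
  by exists (span_rate f i e); [exists e | exact: span_rate_succ_le].
apply: ge_ereal_sup => _ [e /= e0 <-]; apply: le_ereal_sup_tmp.
have [d d0 H] := span_rate_le_succ f i e0.
by exists (span_rate f (i + 1) d) => //; exists d.
Qed.

Lemma entropy_at_nat f (N : nat) : entropy_at N%:Z f = entropy X r f.
Proof.
by elim: N => [//|N <-]; rewrite -addn1 PoszD entropy_at_succ.
Qed.

End spans.

(** * Replacing the tail of a sequence *)

Section tails.
Context {R : realType} {s n : nat} {M : metricType R}.
Variables (X : riemannian s n M) (r : nat).
Implicit Types f g : seq_diffeo X r.

Lemma eq_entropy_at f g i : (forall j, (i <= j)%R -> f j = g j) ->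
  entropy_at i f = entropy_at i g.
Proof.
move=> fg; have fg_orbit k : orbit_map f i k = orbit_map g i k.
  by elim: k => //= k ->; rewrite fg// lerDl.
have fg_dist m x y : orbit_dist f i m x y = orbit_dist g i m x y.
  by apply: eq_bigr => j _; rewrite fg_orbit.
have fg_span m e : min_span f i m e = min_span g i m e.
  congr (inf [set _ | _ in _]); apply/funext => k; apply/propext.
  by split=> -[K [[cK sK] Kk]]; exists K; split=> //; split=> // x;
    have [y Ky xy] := sK x; exists y; rewrite // ?fg_dist// -fg_dist.
have fg_rate : span_rate f i = span_rate g i.
  by apply/funext => e; rewrite /span_rate; under eq_fun do rewrite fg_span.
by rewrite /entropy_at fg_rate.
Qed.

Definition splice f g (N : nat) : seq_diffeo X r :=
  fun i => if i < N%:Z then f i else g i.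

(** Convergence in the product is coordinatewise, and the coordinate [i] equals [f i] as soon as $N
    > |i|$. *)
Lemma splice_cvg f g : splice f g @ \oo --> f.
Proof.
apply/cvg_sup => i A [_ [[C _ <-] Cf] CA]; exists `|i|.+1 => // N /= iN.
by apply: CA; rewrite /= /proj /splice ifT//; lia.
Qed.

Lemma entropy_splice f g N : compact [set: M] ->
  entropy X r (splice f g N) = entropy X r g.
Proof.
move=> cM; rewrite -!(entropy_at_nat cM _ N); apply: eq_entropy_at => j Nj.
by rewrite /splice ltNge Nj.
Qed.

End tails.

Theorem proposition6p1 (R : realType) (r n : nat) (M : metricType R)
    (X : riemannian (maxn r 1) n M) :
  compact [set: M] ->
  is_riemannian_distance X ->
  (exists a b : \bar R,
    [/\ range (entropy X r) a, range (entropy X r) b & a <> b]) ->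
  forall f : seq_diffeo X r, ~ {for f, continuous (entropy X r)}.
Proof.
move=> cM _ [a [b [[fa _ faE] [fb _ fbE] ab]]] f fcont.
have [g fg] : exists g, entropy X r g <> entropy X r f.
  (* Of two distinct values, at least one differs from the entropy of [f]. *)
  have [Ea|Ea] := pselect (entropy X r fa = entropy X r f); last first.
    by exists fa; exact: Ea.
  exists fb => Eb; apply: ab.
  exact: (etrans (esym faE) (etrans Ea (etrans (esym Eb) fbE))).
have cvg_f : entropy X r (splice f g N) @[N --> \oo] --> entropy X r f.
  by apply: (cvg_comp (splice f g)); [exact: splice_cvg | exact: fcont].
have cst_g : (fun N => entropy X r (splice f g N)) = (fun=> entropy X r g).
  by apply/funext => N; exact: entropy_splice.
(* A constant sequence with value the entropy of [g] now tends to that of [f]; limits in the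
   extended reals are unique. *)
rewrite cst_g in cvg_f.
apply: fg; apply: (cvg_unique (@ereal_hausdorff R) _ cvg_f).
exact: cvg_cst.
Qed.
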